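(* Let $n\in\mathbb{N}$ and let $\mathcal{D}\subsetneq\mathcal{C}\subseteq\{0,1\}^n$ be extremal classes such that the pair $(\mathcal{C},\mathcal{D})$ satisfies the cubical colour condition. Let $\mathbb{S}$ be the set of maximal cubes of $\mathcal{C}$ not contained in $\mathcal{D}$. For $c\in\mathbb{S}$ let the special vertex of $c$ be $c\cap c^*$, where $c^*$ is the maximal cube of $\{0,1\}^n\setminus\mathcal{D}$ complementary to $c$. Then sending $c$ to its special vertex is a bijection $\phi:\mathbb{S}\to\mathcal{C}\setminus\mathcal{D}$, and the map $r$ sending each $v\in\mathcal{C}\setminus\mathcal{D}$ to the colour set of $\phi^{-1}(v)$ is a representation mapping of $\mathcal{C}\setminus\mathcal{D}$. Moreover $r$ separates $\mathcal{C}\setminus\mathcal{D}$ from $\mathcal{D}$: for every $v\in\mathcal{C}\setminus\mathcal{D}$ and every $w\in\mathcal{D}$, $v$ and $w$ differ on at least one coordinate in $r(v)$.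
   Context: $[n]=\{1,\dots,n\}$; $\mathrm{proj}_I(v)=(v_i)_{i\in I}$ for $I\subseteq[n]$. A class $\mathcal{C}\subseteq\{0,1\}^n$ shatters $I$ if $\mathrm{proj}_I(\mathcal{C})=\{0,1\}^{|I|}$. A cube with colour set $I\subseteq[n]$ is a set of all points of $\{0,1\}^n$ having prescribed values on $[n]\setminus I$ (its dimension is $|I|$; single vertices are $0$-dimensional cubes). A cube of a class is a cube contained in it; it is maximal if it is not properly contained in another cube of the class. $\mathcal{C}$ is extremal if whenever $\mathcal{C}$ shatters $I$, $\mathcal{C}$ contains a cube with colour set $I$. For extremal classes $\mathcal{D}\subsetneq\mathcal{C}$, the pair $(\mathcal{C},\mathcal{D})$ satisfies the cubical colour condition if for every cube of $\mathcal{C}$ which is not maximal in $\mathcal{C}$ there is a cube of $\mathcal{D}$ with the same colour set. Two cubes $c,c^*$ are complementary if their dimensions sum to $n$ and $c\cap c^*$ is a single vertex. Whenever $\mathcal{D}\subsetneq\mathcal{C}\subseteq\{0,1\}^n$ are extremal classes such that the pair $(\mathcal{C},\mathcal{D})$ satisfies the cubical colour condition, and $\mathbb{S}$ is the set of maximal cubes of $\mathcal{C}$ not contained in $\mathcal{D}$, every $c\in\mathbb{S}$ has exactly one complementary maximal cube $c^*$ in $\{0,1\}^n\setminus\mathcal{D}$. A representation mapping of a set $V\subseteq\{0,1\}^n$ is an injective map $r$ from $V$ to subsets of $[n]$ such that (non-clashing) $\mathrm{proj}_{r(v)\cup r(v')}(v)\neq\mathrm{proj}_{r(v)\cup r(v')}(v')$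 for all $v\neq v'$ in $V$. *)

(* Defs.v *)
From mathcomp Require Import all_boot.
Set Implicit Arguments.
Unset Strict Implicit.
Unset Printing Implicit Defensive.

Notation vertex n := {ffun 'I_n -> bool}.

Section Cubes.
Variable n : nat.
Implicit Types (C D V c : {set vertex n}) (I : {set 'I_n}).

Definition proj I (v : vertex n) : {ffun {i : 'I_n | i \in I} -> bool} :=
  [ffun i => v (val i)].

Definition shatters C I : bool := proj I @: C == setT.

(* The colour set of a cube is determined by its points, so the relation below
   reads "c is a cube and I is its colour set". *)
Definition cube_with_colours I c : bool :=
  [exists a, c == [set v | proj (~: I) v == a]].

Definition cube c : bool := [exists I, cube_with_colours I c].

Definition cube_of C c : bool := cube c && (c \subset C).

Definition maximal_cube C c : bool := maxset (cube_of C) c.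

Definition extremal C : Prop :=
  forall I, shatters C I -> exists2 c, cube_with_colours I c & c \subset C.

Definition cubical_colour_condition C D : Prop :=
  forall I c, cube_with_colours I c -> c \subset C -> ~~ maximal_cube C c ->
  exists2 d, cube_with_colours I d & d \subset D.

Definition complementary c d : Prop :=
  exists I J, [/\ cube_with_colours I c, cube_with_colours J d,
                  #|I| + #|J| = n & exists v, c :&: d = [set v]].

Definition new_maximal_cubes C D : {set {set vertex n}} :=
  [set c | maximal_cube C c && ~~ (c \subset D)].

(* The cube c^* of which the special vertex of c is the intersection with c. *)
Definition dual_cube D c d : Prop :=
  maximal_cube (~: D) d /\ complementary c d.

Definition representation_mapping V (r : vertex n -> {set 'I_n}) : Prop :=
  {in V &, injective r} /\
  {in V &, forall v w, v != w ->
     proj (r v :|: r w) v <> proj (r v :|: r w) w}.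

Definition separates (r : vertex n -> {set 'I_n}) V D : Prop :=
  forall v w, v \in V -> w \in D -> exists2 i, i \in r v & v i != w i.

End Cubes.

(* Main.v *)
Require Import Defs.
From mathcomp Require Import all_boot.

(** Call [I] new if [C], but not [D], contains an [I]-cube.  A new [I] labels a
    vertex [v] when the [I]-cube through [v] lies in [C] and the complementary
    cube through [v] avoids [D].  By the cubical colour condition a new [I] is
    maximal among the colour sets of [C], and since two parallel cubes of an
    extremal class are joined by a gallery of parallel cubes, the [I]-cube of
    [C] and the pattern on [I] missed by [D] are unique; so each new [I] labels
    exactly one vertex.

    That the labels do not clash and cover [C :\: D] is shown by induction on
    the number of coordinates.  Forgetting a coordinate [i] (projection)
    preserves the labels that avoid [i], and keeping the edges of colour [i]
    (reduction) preserves those that contain [i].  In a minimal counterexample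
    two clashing labels are therefore complementary and label the same vertex.
    Moreover every neighbour of such a doubled vertex has no label, and every
    neighbour of an unlabelled vertex of [C :\: D] is doubled.  Hence
    [C :\: D] is the whole cube, contrary to the cubical colour condition. *)

Set Implicit Arguments.
Unset Strict Implicit.
Unset Printing Implicit Defensive.

Section Classes.
Variable n : nat.
Implicit Types (x y v w p : vertex n) (i j : 'I_n) (b : bool).
Implicit Types (A B I J K U : {set 'I_n}) (C D : {set vertex n}).

(** * Faces, missed patterns and classes on a subset of the coordinates *)

(** [A] lists the prescribed coordinates, not the colours, so [face I p] also stands for the pattern
    [p] on [I]. *)
Definition face A v : {set vertex n} :=
  [set w : vertex n | [forall i in A, v i == w i]].

Lemma in_face A v w : reflect {in A, v =1 w} (w \in face A v).
Proof. by rewrite inE; apply: (iffP 'forall_in_eqP) => h i /h. Qed.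

Lemma face_subP A v C :
  reflect (forall w, {in A, v =1 w} -> w \in C) (face A v \subset C).
Proof.
apply: (iffP subsetP) => h w; first by move=> /in_face; apply: h.
by move=> /in_face; apply: h.
Qed.

Lemma face_subCP A v C :
  reflect (forall w, {in A, v =1 w} -> w \notin C) (face A v \subset ~: C).
Proof.
by apply: (iffP (face_subP _ _ _)) => h w /h; rewrite inE.
Qed.

Lemma face_eq A v w : {in A, v =1 w} -> face A v = face A w.
Proof.
move=> vw; apply/setP=> x; apply/in_face/in_face => h i iA.
  by rewrite -vw // h.
by rewrite vw // h.
Qed.

Lemma face_subset A B v : A \subset B -> face B v \subset face A v.
Proof.
by move=> /subsetP AB; apply/face_subP=> w vw; apply/in_face=> i /AB/vw.
Qed.

Lemma face_id A v : v \in face A v.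
Proof. exact/in_face. Qed.

Lemma shattersP C I :
  reflect (forall p, exists2 w, w \in C & {in I, p =1 w}) (shatters C I).
Proof.
apply: (iffP eqP) => [h p | h].
  have : proj I p \in proj I @: C by rewrite h inE.
  case/imsetP=> w wC e; exists w => // i iI.
  by move/ffunP: e => /(_ (exist _ i iI)); rewrite !ffunE.
apply/setP=> a; rewrite inE; apply/imsetP.
have [w wC e] := h [ffun i => if insub i is Some u then a u else false].
exists w => //; apply/ffunP=> u; rewrite ffunE -e ?(valP u) // ffunE valK //.
Qed.

Lemma shattersPn C I :
  reflect (exists p, face I p \subset ~: C) (~~ shatters C I).
Proof.
apply: (iffP idP) => [nsh | [p /face_subCP h]].
  apply/existsP; apply: contraR nsh => /existsPn h; apply/shattersP=> p.
  have /subsetPn[w /in_face e] := h p.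
  by rewrite inE negbK => wC; exists w.
by apply/negP=> /shattersP/(_ p)[w wC /h]; rewrite wC.
Qed.

Definition mix A x y : vertex n := [ffun i => if i \in A then x i else y i].

Definition upd x i b : vertex n := [ffun j => if j == i then b else x j].

Lemma upd_eq x i b : upd x i b i = b.
Proof. by rewrite ffunE eqxx. Qed.

Lemma upd_neq x i b j : j != i -> upd x i b j = x j.
Proof. by rewrite ffunE => /negbTE->. Qed.

Lemma upd_id x i : upd x i (x i) = x.
Proof. by apply/ffunP=> j; rewrite ffunE; case: eqP => [->|]. Qed.

Lemma updK x i b b' : upd (upd x i b) i b' = upd x i b'.
Proof. by apply/ffunP=> j; rewrite !ffunE; case: eqP. Qed.

Lemma face_shatters U C I v : face (U :\: I) v \subset C -> shatters C I.
Proof.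
move=> /face_subP h; apply/shattersP=> p; exists (mix I p v).
  by apply: h => i /setDP[_ /negbTE iI]; rewrite ffunE iI.
by move=> i iI; rewrite ffunE iI.
Qed.

(* A class that depends only on the coordinates in [U] stands for a class in
   [{0,1}^U], and [face (U :\: I) v] for the cube of [{0,1}^U] through [v] with
   colour set [I]. *)
Definition depends_on U C :=
  forall x y, {in U, x =1 y} -> (x \in C) = (y \in C).

Definition extremal_on U C :=
  forall I, I \subset U -> shatters C I ->
  exists v, face (U :\: I) v \subset C.

Lemma depends_onC U C : depends_on U C -> depends_on U (~: C).
Proof. by move=> dC x y e; rewrite !inE (dC x y). Qed.

(** A cube [face I v] in [C] would stop [~: C] from shattering [I]. So [C] misses a pattern on
    [U :\: I], and the points with that pattern form the required cube. *)
Lemma extremal_onC U C : extremal_on U C -> extremal_on U (~: C).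
Proof.
move=> eC I IU /shattersP sh; apply/shattersPn/negP => /eC[|v].
  exact: subsetDl.
rewrite setDDr setDv set0U (setIidPr IU) => /face_subP h.
by have [w] := sh v; rewrite inE => /negP wC /h.
Qed.

(** * Slices, projections and reductions by one coordinate *)

Definition slice i b C : {set vertex n} := [set x | upd x i b \in C].

Definition project i C : {set vertex n} := [set x | [exists b, upd x i b \in C]].

Definition reduce i C : {set vertex n} := [set x | [forall b, upd x i b \in C]].

Lemma in_project i C x : reflect (exists b, upd x i b \in C) (x \in project i C).
Proof. by rewrite inE; apply: existsP. Qed.

Lemma in_reduce i C x : reflect (forall b, upd x i b \in C) (x \in reduce i C).
Proof. by rewrite inE; apply: forallP. Qed.

Lemma upd_agree U i b x y :
  {in U :\ i, x =1 y} -> {in U, upd x i b =1 upd y i b}.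
Proof.
move=> e j jU; rewrite !ffunE; case: eqP => // /eqP ji.
by apply: e; rewrite !inE ji.
Qed.

Lemma depends_slice U i b C :
  depends_on U C -> depends_on (U :\ i) (slice i b C).
Proof. by move=> dC x y e; rewrite !inE; apply/dC/upd_agree. Qed.

Lemma depends_project U i C :
  depends_on U C -> depends_on (U :\ i) (project i C).
Proof.
move=> dC x y e; apply/in_project/in_project => -[b h]; exists b.
  by rewrite -(dC _ _ (upd_agree b e)).
by rewrite (dC _ _ (upd_agree b e)).
Qed.

Lemma depends_reduce U i C :
  depends_on U C -> depends_on (U :\ i) (reduce i C).
Proof.
move=> dC x y e; apply/in_reduce/in_reduce => h b.
  by rewrite -(dC _ _ (upd_agree b e)).
by rewrite (dC _ _ (upd_agree b e)).
Qed.

Lemma upd_agree_colours U I i x y :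
  i \notin I -> {in (U :\ i) :\: I, x =1 y} ->
  {in U :\: I, x =1 upd y i (x i)}.
Proof.
move=> iI e j /setDP[jU jI]; rewrite ffunE; case: eqP => [-> // | /eqP ji].
by apply: e; rewrite !inE jI ji.
Qed.

Lemma face_project U I i v C :
  i \notin I -> face (U :\: I) v \subset C ->
  face ((U :\ i) :\: I) v \subset project i C.
Proof.
move=> iI /face_subP h; apply/face_subP=> w e; apply/in_project.
by exists (v i); apply/h/upd_agree_colours.
Qed.

Lemma face_reduce U I i v C :
  face (U :\: (i |: I)) v \subset C ->
  face ((U :\ i) :\: I) v \subset reduce i C.
Proof.
move=> /face_subP h; apply/face_subP=> w e; apply/in_reduce=> b.
apply: h => j; rewrite !inE negb_or => /andP[/andP[ji jI] jU].
by rewrite upd_neq // e // !inE ji jI.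
Qed.

Lemma face_of_reduce U I i v C :
  face ((U :\ i) :\: I) v \subset reduce i C ->
  face (U :\: (i |: I)) v \subset C.
Proof.
move=> /face_subP h; apply/face_subP=> w e.
rewrite -(upd_id w i); apply/in_reduce/h => j.
rewrite !inE => /andP[jI /andP[ji jU]].
by rewrite e // !inE negb_or ji jI.
Qed.

Lemma shatters_project i I C :
  i \notin I -> shatters (project i C) I = shatters C I.
Proof.
move=> iI; apply/shattersP/shattersP => h p; have [w] := h p.
  case/in_project=> b wC e; exists (upd w i b) => // j jI.
  by rewrite upd_neq ?e //; apply: contraNneq iI => <-.
move=> wC e; exists w => //; apply/in_project; exists (w i).
by rewrite upd_id.
Qed.

Lemma shatters_of_reduce i I C :
  i \notin I -> shatters (reduce i C) I -> shatters C (i |: I).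
Proof.
move=> iI /shattersP h; apply/shattersP=> p; have [w /in_reduce wC e] := h p.
exists (upd w i (p i)) => // j; rewrite !inE => /predU1P[-> | jI].
  by rewrite upd_eq.
by rewrite upd_neq ?e //; apply: contraNneq iI => <-.
Qed.

Lemma subsetD1N U I i : I \subset U :\ i -> I \subset U /\ i \notin I.
Proof. by rewrite subsetD1 => /andP. Qed.

Lemma extremal_project U i C :
  extremal_on U C -> extremal_on (U :\ i) (project i C).
Proof.
move=> eC I /subsetD1N[IU iI]; rewrite shatters_project // => /eC[//|v h].
by exists v; apply: face_project.
Qed.

Lemma extremal_reduce U i C :
  i \in U -> extremal_on U C -> extremal_on (U :\ i) (reduce i C).
Proof.
move=> iU eC I /subsetD1N[IU iI] /(shatters_of_reduce iI)/eC[|v h].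
  by rewrite subUset sub1set iU.
by exists v; apply: face_reduce.
Qed.

Lemma shatters_reduce U i I C :
  extremal_on U C -> i \in U -> I \subset U -> shatters C (i |: I) ->
  shatters (reduce i C) I.
Proof.
move=> eC iU IU /eC[|v /face_reduce]; last exact: face_shatters.
by rewrite subUset sub1set iU.
Qed.

(** An [i |: I]-cube of [C] meets each slice in an [I]-cube. Otherwise [C] misses a pattern [p] on
    [i |: I], which forces every [I]-cube of [C] onto the side [b]. *)
Lemma extremal_slice U i b C :
  i \in U -> extremal_on U C -> extremal_on (U :\ i) (slice i b C).
Proof.
move=> iU eC I /subsetD1N[IU iI] /shattersP sh.
have [shi | /shattersPn[p /face_subCP hp]] := boolP (shatters C (i |: I)).
  have [|v /face_reduce /face_subP h] := eC _ _ shi.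
    by rewrite subUset sub1set iU.
  by exists v; apply/face_subP=> w /h /in_reduce; rewrite inE.
have pb : p i != b.
  apply/eqP=> pb; have [w] := sh p; rewrite inE => + e.
  apply/negP/hp => j; rewrite !inE => /predU1P[-> | jI]; first by rewrite upd_eq.
  by rewrite upd_neq ?e //; apply: contraNneq iI => <-.
have [|v /face_subP hv] := eC _ IU.
  apply/shattersP=> q; have [w] := sh q; rewrite inE => wC e.
  exists (upd w i b) => // j jI.
  by rewrite upd_neq ?e //; apply: contraNneq iI => <-.
have vb : v i = b.
  apply/eqP; apply: contraT => vb.
  have /negP[] : mix I p v \notin C.
    apply: hp => j; rewrite !inE ffunE; case: ifP => // jI /orP[|//].
    by move=> /eqP->; move: pb vb; clear; case: (p i) (v i) b => [] [] [].
  by apply: hv => j /setDP[_ /negbTE jI]; rewrite ffunE jI.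
exists v; apply/face_subP=> w e; rewrite inE -vb.
exact/hv/upd_agree_colours.
Qed.

(** * Neighbours in extremal classes and parallel cubes *)

(** Where [x] and [y] differ at [i], [C] shatters [[set i]] and so has an edge of colour [i]. Either
    [x] lies on it, or induction applies in the slice of [x] to [x] and an end of that edge. *)
Lemma extremal_neighbour U C x y :
  depends_on U C -> extremal_on U C -> x \in C -> y \in C ->
  ~ {in U, x =1 y} -> exists2 i, i \in U & upd x i (~~ x i) \in C.
Proof.
have [m] := ubnP #|U|; elim: m => // m IH in U C y *; rewrite ltnS => leU.
move=> dC eC xC yC xy.
have [i iU xyi] : exists2 i, i \in U & x i != y i.
  apply/exists_inP; apply: contraT => /exists_inPn h; case: xy => i iU.
  by apply/eqP; have := h i iU; rewrite negbK.
have [||v0 /face_subP hv0] := eC [set i]; first by rewrite sub1set.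
  apply/shattersP=> p; have [e|e] := eqVneq (p i) (x i).
    by exists x => // j /set1P->.
  exists y => // j /set1P->.
  by move: e xyi; case: (p i) (x i) (y i) => [] [] [].
have vC b : upd v0 i b \in C.
  by apply: hv0 => j; rewrite !inE => /andP[ji jU]; rewrite upd_neq.
pose v := upd v0 i (x i).
have [/forall_inP xv | nxv] := boolP [forall j in U :\ i, x j == v j].
  exists i => //; rewrite (dC _ (upd v0 i (~~ x i))) //.
  rewrite -(updK v0 i (x i) (~~ x i)).
  by apply: upd_agree => j jU; apply/eqP/xv.
have [||||||j /setD1P[ji jU]] := IH (U :\ i) (slice i (x i) C) v.
- by rewrite (leq_trans _ leU) // [X in _ < X](cardsD1 i) iU.
- exact: depends_slice.
- exact: extremal_slice.
- by rewrite inE upd_id.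
- by rewrite inE updK.
- by move=> xv; case/negP: nxv; apply/forall_inP=> j jU; apply/eqP/xv.
rewrite inE -[X in upd _ i X](_ : upd x j (~~ x j) i = _) ?upd_id; first by exists j.
by rewrite upd_neq // eq_sym.
Qed.

(** The [I]-cubes of [C] form a class [R] extremal on [U :\: I]. A neighbour of [x] in [R] is an
    adjacent parallel cube, and the two together form an [i |: I]-cube. *)
Lemma extremal_extend_face U C I x y :
  depends_on U C -> extremal_on U C -> I \subset U ->
  face (U :\: I) x \subset C -> face (U :\: I) y \subset C ->
  ~ {in U :\: I, x =1 y} ->
  exists2 i, i \in U :\: I & face (U :\: (i |: I)) x \subset C.
Proof.
move=> dC eC IU hx hy xy.
pose R := [set z | face (U :\: I) z \subset C].
have [|||||i iU] := @extremal_neighbour (U :\: I) R x y; rewrite ?inE //.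
- by move=> z w e; rewrite !inE (face_eq e).
- move=> J JU /shattersP sh.
  have [||v /face_subP h] := eC (I :|: J).
  + by rewrite subUset IU (subset_trans JU) // subsetDl.
  + apply/shattersP=> p; have [w] := sh p; rewrite inE => /face_subP wC e.
    exists (mix I p w).
      by apply: wC => j /setDP[_ /negbTE jI]; rewrite ffunE jI.
    move=> j; rewrite inE ffunE; case: (boolP (j \in I)) => //= _; exact: e.
  exists v; apply/face_subP=> w e; rewrite inE; apply/face_subP=> z e'.
  apply: h => j; rewrite !inE negb_or => /andP[/andP[jI jJ] jU].
  by rewrite e ?e' // !inE ?jI ?jJ.
move: hx => /face_subP hx /face_subP hx'; exists i => //.
apply/face_subP=> w e; have [xw|xw] := eqVneq (x i) (w i).
  apply: hx => j; rewrite !inE => /andP[jI jU]; have [->//|ji] := eqVneq j i.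
  by apply: e; rewrite !inE negb_or ji jI.
apply: hx' => j; rewrite !inE => /andP[jI jU]; have [->|ji] := eqVneq j i.
  by rewrite upd_eq; move: xw; case: (x i) (w i) => [] [].
by rewrite upd_neq // e // !inE negb_or ji jI.
Qed.

(** * Cubical pairs and special vertices *)

(** For extremal classes shattered sets are colour sets of cubes, so shattering [i |: I] provides an
    [I]-cube of [C] that is not maximal. *)
Definition cubical_on U C D :=
  forall I i, i \in U -> I \subset U -> i \notin I ->
  shatters C (i |: I) -> shatters D I.

Definition cubical_pair U C D : Prop :=
  [/\ [/\ depends_on U C, extremal_on U C, depends_on U D & extremal_on U D],
      D \subset C & cubical_on U C D].

(* For [U = setT]: [v] is the special vertex of the cube of [C] through [v] with
   colour set [I], its dual cube being [face I v]. *)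
Definition special U C D I v : bool :=
  (face (U :\: I) v \subset C) && (face I v \subset ~: D).

Lemma special_in U C D I v : special U C D I v -> v \in C :\: D.
Proof.
case/andP=> /subsetP/(_ v (face_id _ v)) vC /subsetP/(_ v (face_id _ v)).
by rewrite !inE vC => ->.
Qed.

Lemma special_agree U C D I v w :
  I \subset U -> {in U, v =1 w} -> special U C D I v -> special U C D I w.
Proof.
move=> /subsetP IU e; rewrite /special.
rewrite (@face_eq (U :\: I) v w) ?(@face_eq I v w) // => j; first by move/IU/e.
by case/setDP=> /e.
Qed.

Lemma cubical_pair_project U C D i :
  cubical_pair U C D -> cubical_pair (U :\ i) (project i C) (project i D).
Proof.
case=> -[dC eC dD eD] /subsetP DC cc; split.
- by split; auto using depends_project, extremal_project.
- by apply/subsetP=> x /in_project[b /DC h]; apply/in_project; exists b.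
move=> I j /setD1P[ji jU] /subsetD1N[IU iI] jI.
rewrite !shatters_project //; first exact: cc.
by rewrite !inE eq_sym negb_or ji.
Qed.

Lemma cubical_pair_reduce U C D i : i \in U ->
  cubical_pair U C D -> cubical_pair (U :\ i) (reduce i C) (reduce i D).
Proof.
move=> iU [[dC eC dD eD] /subsetP DC cc]; split.
- by split; auto using depends_reduce, extremal_reduce.
- by apply/subsetP=> x /in_reduce h; apply/in_reduce=> b; apply/DC.
move=> I j /setD1P[ji jU] /subsetD1N[IU iI] jI sh.
apply: (shatters_reduce eD) => //; apply: (cc _ j) => //.
- by rewrite subUset sub1set iU.
- by rewrite !inE negb_or ji.
rewrite setUCA; apply: shatters_of_reduce => //.
by rewrite !inE eq_sym negb_or ji.
Qed.

(** Two different parallel cubes would yield an [i |: I]-cube of [C], and the colour condition would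
    make [D] shatter [I]. *)
Lemma cube_unique U C D I x y :
  cubical_pair U C D -> I \subset U -> ~~ shatters D I ->
  face (U :\: I) x \subset C -> face (U :\: I) y \subset C ->
  {in U :\: I, x =1 y}.
Proof.
case=> -[dC eC dD eD] _ cc IU nsh hx hy.
have [/forall_inP xy j jU|nxy] := boolP [forall j in U :\: I, x j == y j].
  exact/eqP/xy.
have [|i /setDP[iU iI] /face_shatters] := extremal_extend_face dC eC IU hx hy.
  by move=> xy; case/negP: nxy; apply/forall_inP=> j jU; apply/eqP/xy.
by move/(cc _ _ iU IU iI); rewrite (negbTE nsh).
Qed.

(** The dual argument in [~: D], where [face I x] has colour set [U :\: I]: a larger cube there is a
    pattern on [I :\ i] missed by [D], although [C] shatters [I]. *)
Lemma missed_pattern_unique U C D I x y :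
  cubical_pair U C D -> I \subset U -> shatters C I ->
  face I x \subset ~: D -> face I y \subset ~: D -> {in I, x =1 y}.
Proof.
case=> -[dC eC dD eD] _ cc IU sh hx hy.
have [/forall_inP xy j jU|nxy] := boolP [forall j in I, x j == y j].
  exact/eqP/xy.
have UI : U :\: (U :\: I) = I by rewrite setDDr setDv set0U (setIidPr IU).
have [||||i] := extremal_extend_face (I := U :\: I) (x := x) (y := y)
    (depends_onC dD) (extremal_onC eD); rewrite ?UI ?subsetDl //.
  by move=> xy; case/negP: nxy; apply/forall_inP=> j jU; apply/eqP/xy.
move=> iI hi; have iU := subsetP IU i iI.
have /negP[] : ~~ shatters D (I :\ i).
  apply/shattersPn; exists x; suff -> : I :\ i = U :\: (i |: (U :\: I)) by [].
  by rewrite setUC -setDDl UI.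
by apply: (cc _ i); rewrite ?setD11 ?setD1K // (subset_trans (subD1set _ _)).
Qed.

Lemma special_unique U C D I v w :
  cubical_pair U C D -> I \subset U ->
  special U C D I v -> special U C D I w -> {in U, v =1 w}.
Proof.
move=> pCD IU /andP[cv dv] /andP[cw dw] j jU; have [jI|jI] := boolP (j \in I).
  exact: (missed_pattern_unique pCD IU (face_shatters cv) dv dw).
apply: (cube_unique pCD IU _ cv cw); last by rewrite inE jI.
by apply/shattersPn; exists v.
Qed.

Lemma special_project U C D I v i : i \notin I ->
  special U C D I v -> special (U :\ i) (project i C) (project i D) I v.
Proof.
move=> iI /andP[cv /face_subCP dv]; rewrite /special face_project //=.
apply/face_subCP=> w e; apply/in_project=> -[b]; apply/negP/dv => j jI.
by rewrite upd_neq ?e //; apply: contraNneq iI => <-.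
Qed.

Lemma special_reduce U C D I v i : i \in I ->
  special U C D I v ->
  special (U :\ i) (reduce i C) (reduce i D) (I :\ i) v.
Proof.
move=> iI /andP[cv /face_subCP dv].
rewrite /special face_reduce ?setD1K //=.
apply/face_subCP=> w e; apply/in_reduce=> /(_ (v i)); apply/negP/dv => j jI.
rewrite ffunE; case: eqP => [->|/eqP ji] //.
by rewrite e // !inE ji.
Qed.

Lemma special_of_project U C D I v i :
  cubical_pair U C D -> i \in U -> I \subset U :\ i ->
  special (U :\ i) (project i C) (project i D) I v ->
  exists b, special U C D I (upd v i b).
Proof.
move=> pCD iU IUi /andP[cv /face_subCP dv].
have [IU iI] := subsetD1N IUi.
have dI b : face I (upd v i b) \subset ~: D.
  apply/face_subCP=> w e; apply: contra (dv w _) => [wD|].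
    by apply/in_project; exists (w i); rewrite upd_id.
  by move=> j jI; rewrite -e // upd_neq //; apply: contraNneq iI => <-.
have [[dC eC _ _] _ _] := pCD.
have [|y cy] := eC _ IU.
  by rewrite -(shatters_project _ iI); apply: face_shatters cv.
(* The value comes from an [I]-cube of [C] through [y], which projects onto the unique [I]-cube of
   the projection. *)
exists (y i); rewrite /special dI andbT -(@face_eq _ y) // => j jUI.
rewrite ffunE; case: eqP => [->|/eqP ji] //.
apply: (cube_unique (cubical_pair_project i pCD) IUi _ (face_project iI cy) cv).
  by apply/shattersPn; exists v; apply/face_subCP.
by move: jUI; rewrite !inE ji.
Qed.

Lemma special_of_reduce U C D I v i :
  cubical_pair U C D -> i \in U -> I \subset U :\ i ->
  special (U :\ i) (reduce i C) (reduce i D) I v ->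
  exists b, special U C D (i |: I) (upd v i b).
Proof.
move=> pCD iU IUi /andP[cv dv].
have [IU iI] := subsetD1N IUi.
have [[_ _ _ eD] _ _] := pCD.
have /shattersPn[p dp] : ~~ shatters D (i |: I).
  apply: contraL dv => /(shatters_reduce eD iU IU)/shattersP/(_ v)[w wD e].
  by apply/negP=> /face_subCP/(_ w e); rewrite wD.
(* The value comes from a pattern [p] missed by [D] on [i |: I]; on [I] it is missed by
   [reduce i D], hence agrees with [v]. *)
exists (p i); apply/andP; split.
  rewrite (@face_eq _ _ v) ?face_of_reduce // => j.
  by rewrite !inE negb_or => /andP[/andP[ji _] _]; rewrite upd_neq.
rewrite -(@face_eq _ p) // => j; rewrite !inE => /predU1P[->|jI].
  by rewrite upd_eq.
rewrite upd_neq; last by apply: contraNneq iI => <-.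
apply: (missed_pattern_unique (cubical_pair_reduce iU pCD) IUi _ _ dv) => //.
  exact: face_shatters cv.
apply/face_subCP=> w e; apply/in_reduce=> /(_ (p i)); apply/negP.
move/face_subCP: dp; apply=> k; rewrite !inE => /predU1P[->|kI].
  by rewrite upd_eq.
by rewrite upd_neq ?e //; apply: contraNneq iI => <-.
Qed.

(** * Non-clashing and covering by induction on the coordinates *)

Definition non_clashing U C D :=
  forall I J v w, I \subset U -> J \subset U ->
  special U C D I v -> special U C D J w -> {in I :|: J, v =1 w} -> I = J.

Definition covering U C D :=
  forall v, v \in C :\: D -> exists2 I : {set 'I_n}, I \subset U & special U C D I v.

Section Step.
Variables (U : {set 'I_n}) (C D : {set vertex n}).
Hypothesis pCD : cubical_pair U C D.
Hypothesis IHproject : forall i, i \in U ->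
  non_clashing (U :\ i) (project i C) (project i D) /\
  covering (U :\ i) (project i C) (project i D).
Hypothesis IHreduce : forall i, i \in U ->
  non_clashing (U :\ i) (reduce i C) (reduce i D) /\
  covering (U :\ i) (reduce i C) (reduce i D).

Definition doubled v :=
  exists I J, [/\ I \subset U, J \subset U, I != J,
                  special U C D I v & special U C D J v].

Definition uncovered v :=
  v \in C :\: D /\ forall I, I \subset U -> ~~ special U C D I v.

Lemma agree_upd A v i b : i \notin A -> {in A, v =1 upd v i b}.
Proof. by move=> iA j jA; rewrite upd_neq //; apply: contraNneq iA => <-. Qed.

(** A clash of labels that share [i] would survive reduction, and a clash of labels that both avoid
    [i] would survive projection. *)
Lemma clash_complementary I J v w :
  I \subset U -> J \subset U -> I != J ->
  special U C D I v -> special U C D J w -> {in I :|: J, v =1 w} ->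
  forall i, i \in U -> (i \in J) = (i \notin I).
Proof.
move=> IU JU IJ sI sJ e i iU.
have [iI|iI] := boolP (i \in I); have [iJ|iJ] := boolP (i \in J) => //.
  have [nc _] := IHreduce iU; case/eqP: IJ.
  rewrite -(setD1K iI) -(setD1K iJ); congr (_ |: _).
  apply: (nc _ _ v w); rewrite ?setSD ?special_reduce // => j.
  by rewrite -setDUl => /setD1P[_ /e].
have [nc _] := IHproject iU; case/eqP: IJ.
by apply: (nc _ _ v w); rewrite ?subsetD1 ?special_project ?IU ?JU.
Qed.

(** Complementary labels cover [U], so [v] and [w] agree on [U] and share both labels. *)
Lemma clash_doubled I J v w :
  I \subset U -> J \subset U -> I != J ->
  special U C D I v -> special U C D J w -> {in I :|: J, v =1 w} ->
  doubled v.
Proof.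
move=> IU JU IJ sI sJ e; exists I, J; split => //.
apply: (special_agree JU _ sJ) => i iU; rewrite e //.
by rewrite inE (clash_complementary IU JU IJ sI sJ e iU) orbN.
Qed.

(** The label containing [i] keeps the neighbour in [C], the other keeps it out of [D]. A label of
    the neighbour would, after reduction or projection, equal one of the labels of [v], against
    [special_unique]. *)
Lemma doubled_neighbour_uncovered v i :
  doubled v -> i \in U -> uncovered (upd v i (~~ v i)).
Proof.
case=> I [J [IU JU IJ sI sJ]] iU.
wlog iI : I J IU JU IJ sI sJ / i \in I.
  move=> W; have iJ := clash_complementary IU JU IJ sI sJ (fun=> fun=> erefl) iU.
  have [iI|iI] := boolP (i \in I); first exact: (W I J).
  by apply: (W J I) => //; rewrite ?iJ 1?eq_sym.
have := clash_complementary IU JU IJ sI sJ (fun=> fun=> erefl) iU.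
rewrite iI => /negbT iJ; set b := ~~ v i.
have nv (K : {set 'I_n}) : K \subset U -> special U C D K v ->
    special U C D K (upd v i b) -> False.
  move=> KU s s'; have := special_unique pCD KU s s' iU.
  by rewrite upd_eq /b; case: (v i).
split.
  rewrite inE; case/andP: sI => /face_subP -> //; last first.
    by apply: agree_upd; rewrite inE iI.
  case/andP: sJ => _ /face_subCP -> //; exact: agree_upd.
move=> K KU; apply/negP=> sK; have [iK|iK] := boolP (i \in K).
  have [nc _] := IHreduce iU.
  suff KI : K = I by apply: (nv K) => //; rewrite KI.
  rewrite -(setD1K iK) -(setD1K iI); congr (_ |: _).
  apply: (nc _ _ (upd v i b) v); rewrite ?setSD ?special_reduce // => j.
  by rewrite -setDUl => /setD1P[ji _]; rewrite upd_neq.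
have [nc _] := IHproject iU.
suff KJ : K = J by apply: (nv K) => //; rewrite KJ.
apply: (nc _ _ (upd v i b) v); rewrite ?subsetD1 ?KU ?JU ?special_project //.
by move=> j jKJ; apply/esym/(@agree_upd (K :|: J)); rewrite // inE negb_or iK.
Qed.

(** Labels of [v] in the projection or reduction lift to an end of the edge from [v] to [w], and [v]
    has none, so they sit at [w]: one avoids [i], the other contains it. *)
Lemma uncovered_neighbour_doubled v i :
  uncovered v -> i \in U -> doubled (upd v i (~~ v i)).
Proof.
case=> vCD nv iU; set w := upd v i (~~ v i).
have [_ /subsetP DC _] := pCD.
have vU b (P : vertex n -> bool) : P (upd v i b) -> ~~ P v -> P w.
  have [<-|bv] := eqVneq (v i) b; first by rewrite upd_id => ->.
  by rewrite /w; case: (v i) b bv => [] [].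
have /setDP[vC vD] := vCD.
have vb (E : {set vertex n}) : v \in E -> w \in E -> v \in reduce i E.
  move=> vE wE; apply/in_reduce=> b; have [<-|bv] := eqVneq (v i) b.
    by rewrite upd_id.
  by move: wE; rewrite /w; case: (v i) b bv => [] [].
have reduceP : w \in C -> exists I,
    [/\ i \in I, I \subset U & special U C D I w].
  move=> wC; have [_ cov] := IHreduce iU.
  have [|I IUi s] := cov v.
    apply/setDP; split; first exact: vb.
    by apply/in_reduce=> /(_ (v i)); rewrite upd_id (negbTE vD).
  have [b sb] := special_of_reduce pCD iU IUi s.
  have [IU iI] := subsetD1N IUi.
  have iIU : i |: I \subset U by rewrite subUset sub1set iU.
  by exists (i |: I); split; rewrite ?setU11 //; apply: vU sb (nv _ iIU).
have wD : w \notin D.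
  apply/negP=> wD; have [I [_ _ /special_in]] := reduceP (DC _ wD).
  by rewrite inE wD.
(* With both ends outside [D] the projection applies; its label puts [w] in [C], which makes the
   reduction available. *)
have [_ cov] := IHproject iU; have [|I IUi s] := cov v.
  apply/setDP; split; first by apply/in_project; exists (v i); rewrite upd_id.
  apply/in_project=> -[b bD]; case/negP: wD.
  exact: (vU b (mem D)).
have [b sb] := special_of_project pCD iU IUi s.
have [IU iI] := subsetD1N IUi.
have sw := vU b _ sb (nv _ IU).
have /setDP[wC _] := special_in sw.
have [J [iJ JU sJ]] := reduceP wC.
by exists I, J; split => //; apply: contraNneq iI => ->.
Qed.

Lemma doubled_in v : doubled v -> v \in C :\: D.
Proof. by case=> I [J [_ _ _ /special_in]]. Qed.

(* Doubled and uncovered vertices alternate along the edges of the cube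
   [{0,1}^U], so they fill it as soon as one of them exists. *)
Lemma no_doubled_or_uncovered v : ~ (doubled v \/ uncovered v).
Proof.
move=> bad_v; have [[dC eC dD eD] _ cc] := pCD.
(* Induction on the number of coordinates where [w] differs from [v]; crossing one edge swaps the
   two cases. *)
have all_bad w : (forall i, i \notin U -> w i = v i) -> doubled w \/ uncovered w.
  have [m] := ubnP #|[set i | w i != v i]|; elim: m => // m IH in w *.
  rewrite ltnS => le_m wv.
  have [e|] := eqVneq [set i | w i != v i] set0.
    suff -> : w = v by []; apply/ffunP=> i; apply/eqP; apply: contraT => ne.
    by have := in_set0 i; rewrite -e inE ne.
  case/set0Pn=> i; rewrite inE => ne.
  have iU : i \in U by apply: contraR ne => /wv->.
  have {}IH : doubled (upd w i (v i)) \/ uncovered (upd w i (v i)).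
    apply: IH => [|j jU].
      apply: leq_trans le_m; rewrite [X in _ < X](cardsD1 i) inE ne add1n ltnS.
      apply/subset_leq_card/subsetP=> j; rewrite !inE ffunE.
      by have [->|] := eqVneq j i; rewrite ?eqxx.
    by rewrite ffunE; case: eqP => [->|_] //; apply: wv.
  have -> : w = upd (upd w i (v i)) i (~~ upd w i (v i) i).
    rewrite upd_eq updK -[LHS](upd_id w i); congr upd.
    by move: ne; case: (w i) (v i) => [] [].
  case: IH => h; first by right; apply: doubled_neighbour_uncovered.
  by left; apply: uncovered_neighbour_doubled.
have full w : w \in C :\: D.
  rewrite inE (dC _ (mix U w v)) ?(dD _ (mix U w v)); last 2 first.
  - by move=> i iU; rewrite ffunE iU.
  - by move=> i iU; rewrite ffunE iU.
  have [i /negbTE iU||[]] := all_bad (mix U w v); first by rewrite ffunE iU.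
  - by move/doubled_in; rewrite inE.
  - by rewrite inE.
(* Without coordinates the only possible label is [set0], and [full] makes it a label. *)
have [U0|[i iU]] := set_0Vmem U.
  case: bad_v => [[I [J [IU JU]]]|[vCD /(_ set0 (sub0set _))/negP[]]].
    by move: IU JU; rewrite U0 !subset0 => /eqP-> /eqP->; rewrite eqxx.
  rewrite /special; apply/andP; split; apply/face_subP=> w _.
    by case/setDP: (full w).
  by rewrite inE; case/setDP: (full w).
(* Shattering [set0] means being nonempty, so the colour condition at [i] gives [D] a point. *)
have /shattersP/(_ v)[w wD _] : shatters D set0.
  apply: (cc _ i); rewrite ?sub0set ?inE //; apply/shattersP=> p.
  by exists p => //; case/setDP: (full p).
by have := full w; rewrite inE wD.
Qed.

End Step.

Lemma non_clashing_covering U C D :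
  cubical_pair U C D -> non_clashing U C D /\ covering U C D.
Proof.
have [m] := ubnP #|U|; elim: m => // m IH in U C D *; rewrite ltnS => leU pCD.
have lt i : i \in U -> #|U :\ i| < m.
  by move=> iU; rewrite (leq_trans _ leU) // [X in _ < X](cardsD1 i) iU.
have IHp i iU := IH _ _ _ (lt i iU) (cubical_pair_project i pCD).
have IHr i iU := IH _ _ _ (lt i iU) (cubical_pair_reduce iU pCD).
have none v := no_doubled_or_uncovered pCD IHp IHr (v := v).
split=> [I J v w IU JU sI sJ e | v vCD].
  apply/eqP; apply: contraT => IJ; case: (none v); left.
  exact: clash_doubled sI sJ e.
have [/exists_inP//|/exists_inPn h] :=
  boolP [exists (I : {set 'I_n} | I \subset U), special U C D I v].
by case: (none v); right.
Qed.

(** * Cubes and maximality in terms of faces *)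

Lemma cube_with_coloursP I c :
  reflect (exists v, c = face (~: I) v) (cube_with_colours I c).
Proof.
have projE v w : (proj (~: I) w == proj (~: I) v) = (w \in face (~: I) v).
  apply/eqP/in_face => [e j jI | e].
    by move/ffunP: e => /(_ (exist _ j jI)); rewrite !ffunE.
  by apply/ffunP=> u; rewrite !ffunE e // (valP u).
apply: (iffP existsP) => [[a /eqP->] | [v ->]]; last first.
  by exists (proj (~: I) v); apply/eqP/setP=> w; rewrite [RHS]inE projE.
have [v <-] : exists v, proj (~: I) v = a.
  exists [ffun i => if insub i is Some u then a u else false].
  by apply/ffunP=> u; rewrite !ffunE valK.
by exists v; apply/setP=> w; rewrite [LHS]inE projE.
Qed.

Lemma cube_of_face C I v : face (~: I) v \subset C -> cube_of C (face (~: I) v).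
Proof.
move=> vC; rewrite /cube_of vC andbT; apply/existsP; exists I.
by apply/cube_with_coloursP; exists v.
Qed.

Lemma face_sub_colours I J v w :
  face (~: I) v \subset face (~: J) w -> I \subset J.
Proof.
move=> /face_subP h; apply/subsetP=> i iI; apply: contraT => iJ.
have ij : i \in ~: J by rewrite inE.
have /in_face/(_ i ij) := h v (fun=> fun=> erefl).
have /in_face/(_ i ij) : upd v i (~~ v i) \in face (~: J) w.
  by apply: h; apply: agree_upd; rewrite inE iI.
by rewrite upd_eq => -> /eqP; case: (v i).
Qed.

Lemma face_colours_inj I J v w : face (~: I) v = face (~: J) w -> I = J.
Proof.
by move=> e; apply/eqP; rewrite eqEsubset (@face_sub_colours I J v w) ?e //
  (@face_sub_colours J I w v) ?e.
Qed.

Lemma face_sub_eq I v w : w \in face I v -> face I v = face I w.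
Proof. by move/in_face/face_eq. Qed.

(** A larger cube contains one through [v] with a single extra colour, so only these need
    testing. *)
Lemma maximal_faceP C I v :
  face (~: I) v \subset C ->
  reflect (forall i, i \notin I -> ~~ (face (~: (i |: I)) v \subset C))
          (maximal_cube C (face (~: I) v)).
Proof.
move=> vC; apply: (iffP maxsetP) => [[_ h] i iI | h].
  apply/negP=> /cube_of_face/h e; case/negP: iI.
  rewrite -(face_colours_inj (e _)) ?setU11 //.
  apply/subsetP=> w /in_face vw; apply/in_face=> j.
  by rewrite !inE negb_or => /andP[_ jI]; apply: vw; rewrite inE.
split=> [|d /andP[/existsP[J /cube_with_coloursP[w ->]] dC] sub].
  exact: cube_of_face.
have IJ := face_sub_colours sub.
have wv : face (~: J) w = face (~: J) v.
  exact/face_sub_eq/(subsetP sub)/face_id.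
have [JI|/subsetPn[i iJ iI]] := boolP (J \subset I).
  by rewrite wv (_ : J = I) //; apply/eqP; rewrite eqEsubset JI.
case/negP: (h i iI); apply: subset_trans dC; rewrite wv; apply: face_subset.
by rewrite setCS subUset sub1set iJ.
Qed.

Lemma face_setIC I v : face (~: I) v :&: face I v = [set v].
Proof.
apply/setP=> w; rewrite !inE; apply/idP/eqP => [|->].
  case/andP=> /forall_inP h1 /forall_inP h2; apply/ffunP=> i; apply/esym/eqP.
  by have [/h2//|iI] := boolP (i \in I); apply: h1; rewrite inE.
by apply/andP; split; apply/forall_inP.
Qed.

Lemma depends_onT C : depends_on setT C.
Proof. by move=> x y e; congr (_ \in C); apply/ffunP=> i; apply: e. Qed.

Lemma extremal_onT C : extremal C -> extremal_on setT C.
Proof.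
move=> eC I _ /eC[c /cube_with_coloursP[v ->] vC].
by exists v; rewrite setTD.
Qed.

Lemma cubical_pairT C D :
  extremal C -> extremal D -> D \subset C -> cubical_colour_condition C D ->
  cubical_pair setT C D.
Proof.
move=> /extremal_onT eC /extremal_onT eD DC cc; split=> //.
  by split=> //; apply: depends_onT.
move=> I i _ _ iI /eC[|x]; rewrite ?subsetT // setTD => xC.
have xC' : face (~: I) x \subset C.
  by apply: subset_trans xC; apply: face_subset; rewrite setCS subsetUr.
have [||d /cube_with_coloursP[y ->] yD] := cc I (face (~: I) x) _ xC'.
- by apply/cube_with_coloursP; exists x.
- by apply/(maximal_faceP xC') => /(_ i iI); rewrite xC.
by apply: (@face_shatters setT _ _ y); rewrite setTD.
Qed.

(** * New maximal cubes, special vertices and dual cubes *)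

Section Special.
Variables (C D : {set vertex n}).
Hypothesis pCD : cubical_pair setT C D.

(** If [D] shattered [I], it would contain an [I]-cube parallel to [c] and different from it, and
    [c] could be extended in [C]. So [D] misses a pattern on [I], and the point of [c] with this
    pattern is special. *)
Lemma new_maximal_special c : c \in new_maximal_cubes C D ->
  exists I v, c = face (~: I) v /\ special setT C D I v.
Proof.
rewrite inE => /andP[mc ncD]; have [[dC eC dD eD] DC cc] := pCD.
have /maxsetp/andP[/existsP[I /cube_with_coloursP[x ec]] cC] := mc.
rewrite ec in mc ncD cC *.
have /shattersPn[p hp] : ~~ shatters D I.
  apply/negP=> /eD[|y]; rewrite ?subsetT // setTD => yD.
  have yC := subset_trans yD DC.
  have [/forall_inP xy|nxy] := boolP [forall j in ~: I, y j == x j].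
    case/negP: ncD; rewrite -(@face_eq _ y) // => j jI; exact/eqP/xy.
  have [|||i] := extremal_extend_face dC eC (subsetT I) (x := x) (y := y);
    rewrite ?setTD //.
    by move=> xy; case/negP: nxy; apply/forall_inP=> j jI; rewrite xy.
  by rewrite inE => iI xC; case/negP: (maximal_faceP cC mc i iI).
have e : {in ~: I, x =1 mix I p x}.
  by move=> i; rewrite inE ffunE => /negbTE->.
exists I, (mix I p x); split; first exact: face_eq.
rewrite /special setTD -(face_eq e) cC -(@face_eq _ p) // => i iI.
by rewrite ffunE iI.
Qed.

Lemma special_new_maximal I v :
  special setT C D I v -> face (~: I) v \in new_maximal_cubes C D.
Proof.
move=> s; have /setDP[_ vD] := special_in s.
move: s; rewrite /special setTD => /andP[cv dv].
rewrite inE; apply/andP; split; last first.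
  by apply: contra vD => /subsetP; apply; apply: face_id.
have [_ _ cc] := pCD; apply/maximal_faceP => // i iI; apply/negP=> h.
have /negP[] : ~~ shatters D I by apply/shattersPn; exists v.
apply: (cc _ i); rewrite ?subsetT ?in_setT //; apply: (@face_shatters setT _ _ v).
by rewrite setTD.
Qed.

(** If [face I v] could be enlarged in [~: D], then [D] would miss a pattern on some [I :\ i], which
    it must shatter because [C] shatters [I]. *)
Lemma special_dual_cube I v :
  special setT C D I v -> dual_cube D (face (~: I) v) (face I v).
Proof.
rewrite /special setTD => /andP[cv dv]; have [_ _ cc] := pCD; split.
  rewrite -{1}(setCK I); rewrite -{1}(setCK I) in dv.
  apply/(maximal_faceP dv) => i; rewrite inE negbK setCU setCK => iI; apply/negP=> h.
  have /negP[] : ~~ shatters D (I :\ i).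
    by apply/shattersPn; exists v; rewrite setDE setIC.
  apply: (cc _ i); rewrite ?subsetT ?in_setT ?setD11 ?setD1K //.
  by apply: (@face_shatters setT _ _ v); rewrite setTD.
exists I, (~: I); split.
- by apply/cube_with_coloursP; exists v.
- by apply/cube_with_coloursP; exists v; rewrite setCK.
- by rewrite cardsC card_ord.
by exists v; apply: face_setIC.
Qed.

Lemma dual_cube_special I v d :
  special setT C D I v -> dual_cube D (face (~: I) v) d -> d = face I v.
Proof.
rewrite /special setTD => /andP[cv dv].
case=> /maxsetp/andP[_ dD] [I' [J [/cube_with_coloursP[x ex]]]].
case/cube_with_coloursP=> y ey IJn [u cdu].
have {x ex} eI := face_colours_inj ex; rewrite -{}eI in IJn.
have /setIP[uc ud] : u \in face (~: I) v :&: d by rewrite cdu set11.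
have edu : d = face (~: J) u by rewrite ey; apply: face_sub_eq; rewrite -ey.
have ecu := face_sub_eq uc.
(* A common colour would give the two cubes a second common vertex; the dimensions then force
   [J = ~: I]. *)
have JI : J \subset ~: I.
  apply/subsetP=> i iJ; rewrite inE; apply/negP=> iI.
  have : upd u i (~~ u i) \in face (~: I) v :&: d.
    by rewrite ecu edu inE; apply/andP; split; apply/in_face/agree_upd;
      rewrite inE ?iI ?iJ.
  rewrite cdu inE => /eqP/ffunP/(_ i); rewrite upd_eq.
  by case: (u i).
have {}JI : J = ~: I.
  apply/eqP; rewrite eqEcard JI /=.
  by rewrite -(leq_add2l #|I|) IJn cardsC card_ord.
rewrite JI setCK in edu; rewrite edu; apply: face_eq.
apply: (missed_pattern_unique pCD (subsetT I)) => //; last by rewrite -edu.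
by apply: (@face_shatters setT _ _ v); rewrite setTD.
Qed.

End Special.

End Classes.

(* The first conjunct says that the special vertex of each cube in S is well
   defined. In the second, phi is any function that sends each c in S to its
   special vertex, and r is any function whose value at phi c is the colour set
   of c for each c in S; their values elsewhere are irrelevant. *)
Theorem mainTheorem5 (n : nat) (C D : {set vertex n}) :
  extremal C -> extremal D -> D \proper C -> cubical_colour_condition C D ->
  let S := new_maximal_cubes C D in
  (forall c, c \in S -> exists! d, dual_cube D c d) /\
  (forall phi : {set vertex n} -> vertex n,
     (forall c d, c \in S -> dual_cube D c d -> c :&: d = [set phi c]) ->
     [/\ {in S &, injective phi},
         phi @: S = C :\: D &
         forall r : vertex n -> {set 'I_n},
           (forall c, c \in S -> cube_with_colours (r (phi c)) c) ->
           representation_mapping (C :\: D) r /\ separates r (C :\: D) D]).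
Proof.
move=> eC eD /proper_sub DC cc S; have pCD := cubical_pairT eC eD DC cc.
have [nc cov] := non_clashing_covering pCD.
split=> [c /(new_maximal_special pCD)[I [v [-> s]]] | phi hphi].
  exists (face I v); split=> [|d /(dual_cube_special pCD s)//].
  exact: (special_dual_cube pCD).
have phiE I v : special setT C D I v -> phi (face (~: I) v) = v.
  move=> s; have := hphi _ _ (special_new_maximal pCD s) (special_dual_cube pCD s).
  by rewrite face_setIC => /set1_inj.
have imS : phi @: S = C :\: D.
  apply/setP=> v; apply/imsetP/idP => [[c cS ->] | /cov[I _ s]].
    have [I [w [-> s]]] := new_maximal_special pCD cS.
    by rewrite phiE // (special_in s).
  by exists (face (~: I) v); rewrite ?phiE ?special_new_maximal.
split=> // [c c' | r hr].
  case/(new_maximal_special pCD)=> I [v [-> s]].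
  case/(new_maximal_special pCD)=> J [w [-> s']]; rewrite !phiE // => vw.
  by rewrite (nc I J v w) ?subsetT // vw.
have rS v : v \in C :\: D -> special setT C D (r v) v.
  case/cov=> I _ s; have /hr := special_new_maximal pCD s.
  by rewrite phiE // => /cube_with_coloursP[x /face_colours_inj <-].
have r_inj : {in C :\: D &, injective r}.
  move=> v w /rS sv /rS sw e; rewrite -e in sw.
  by apply/ffunP=> i; apply: (special_unique pCD (subsetT _) sv sw).
split; first split=> // v w vCD wCD vw e.
  case/eqP: vw; apply: r_inj => //.
  apply: (nc _ _ v w); rewrite ?subsetT ?rS // => i iI.
  by move/ffunP: e => /(_ (exist _ i iI)); rewrite !ffunE.
(* A vertex agreeing with [v] on [r v] lies in [face (r v) v], which avoids [D]. *)
move=> v w /rS/andP[_ /face_subCP h] wD; apply/exists_inP.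
apply: contraLR wD => /exists_inPn e; apply: h => i /e.
by rewrite negbK => /eqP.
Qed.
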